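(* Let $X$ be a filtered chain complex with at least one non-trivial differential, let $\mathcal{G}=\{x_1,\dots,x_m\}$ be a totally ordered quasi-minimal set of generators of $X$, and let $d=(d^k_h)_{1\le k,h\le m}$ be the total boundary matrix of $X$ with respect to $\mathcal{G}$. Let $(x_i,x_j)$ be a pair of generators in $\mathcal{G}$ satisfying the split conditions SC1, SC2, SC3. Then there exists a quasi-minimal set of generators $\tilde{\mathcal{G}}=\{\tilde x_1,\dots,\tilde x_m\}$ of $X$ for which: 1. $\tilde x_j=x_j$, $\tilde x_i=\delta(x_j)$, and the pair $(\tilde x_i,\tilde x_j)$ satisfies the split conditions SC1, SC2, SC3 (with respect to $\tilde{\mathcal G}$ and its total boundary matrix); 2. each $\tilde x_k\in\tilde{\mathcal{G}}$ has the same degree and entrance time as $x_k\in\mathcal{G}$, for $k=1,\dots,m$; 3. $X\cong I^n[s,e)\oplus X'$, where $n=\deg(\tilde x_i)$, $s=\mathrm{ent}(\tilde x_i)$, $e=\mathrm{ent}(\tilde x_j)$, and $X'$ is the filtered chain complex generated by $\mathcal{G}'=\tilde{\mathcal{G}}\setminus\{\tilde x_i,\tilde x_j\}$ with differential $\delta'$ induced by $\delta$; 4. the $(m-2)\times(m-2)$ total boundary matrix $d'$ of $X'$ with respect to $\mathcal{G}'$ is obtained from the $m\times m$ total boundary matrix $d$ of $X$ with respect to $\mathcal{G}$ by adding to each $k$-th row with $d^k_j\neq 0$ the $i$-th row (of $d$) multiplied by $-(d^i_j)^{-1}d^k_j$, and then removing the $i$-th and $j$-th columns and the $i$-th and $j$-th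 rows.
   Context: $\mathbb{F}$ is a finite prime field. Chain complexes are non-negatively graded complexes of $\mathbb{F}$-vector spaces and are assumed compact, i.e. $\bigoplus_n C_n$ is finite dimensional; $\mathbf{ch}$ is the category of these. A functor $X\colon[0,\infty)\to\mathbf{ch}$ has values $X^t$ and transition morphisms $X^{s\le t}\colon X^s\to X^t$; $X_n^t$ is the degree $n$ part of $X^t$; $\delta$ denotes the differential of $X$. $X$ is tame if there is a finite sequence $0=\tau_0<\dots<\tau_k$ such that $X^{s\le t}$ may fail to be an isomorphism only when $s<\tau_a\le t$ for some $a\in\{1,\dots,k\}$. A filtered chain complex is a tame $X$ all of whose transition morphisms are monomorphisms. Interval spheres: $S^n$ is the complex equal to $\mathbb{F}$ in degree $n$ and $0$ elsewhere; $D^{n+1}$ is the complex equal to $\mathbb{F}$ in degrees $n+1$ and $n$, with identity differential between them, and $0$ elsewhere. For $n\in\mathbb{N}$, $0\le s<\infty$ and $s\le e\le\infty$, the interval sphere $I^n[s,e)$ is the filtered chain complex (up to isomorphism) with $I^n[s,e)^t=0$ for $t<s$, $S^n$ for $s\le t<e$, $D^{n+1}$ for $e\le t<\infty$, with transition morphisms the evident inclusions $0\hookrightarrow S^n\hookrightarrow D^{n+1}$ and identities. (The case $s=e<\infty$ is allowed.) Generators: each generator $x$ has a degree $\deg(x)=n$ and an entrance time $\mathrm{ent}(x)=t$, with $x\in X_n^t$; a finite set $\mathcal G$ of such elements generates $X$ if the elements, their images under transition morphisms, and the differentials of these span every $X_n^t$ (equivalently, the induced morphism $\bigoplus_{x\in\mathcal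 G} I^{\deg(x)-1}[\mathrm{ent}(x),\mathrm{ent}(x))\to X$ is an epimorphism, where $I^{-1}[s,s)$ means $I^0[s,\infty)$). The radical $\mathrm{rad}X_n\subset X_n$ has value at $t$ the sum of the images of $X_n^{s<t}$ over all $s<t$. $\mathcal G$ is quasi-minimal if for all $n$ and $t$ the set $\{x\in\mathcal G: \mathrm{ent}(x)=t,\ \deg(x)=n\}$ is (maps bijectively onto) a basis of $(X_n/\mathrm{rad}X_n)^t$. Then, for each $n,t$, the images in $X_n^t$ of the generators of degree $n$ and entrance time $\le t$ form a basis of $X_n^t$. Since transition morphisms are injective, elements are identified with their images under them. Total boundary matrix: for $\mathcal G=\{x_1,\dots,x_m\}$ quasi-minimal (with an arbitrary total order), $d=(d^i_j)$ is the $m\times m$ matrix determined by $\delta(x_j)=\sum_{i} d^i_j x_i$ (where only $x_i$ with $\deg(x_i)=\deg(x_j)-1$ and $\mathrm{ent}(x_i)\le\mathrm{ent}(x_j)$ occur with non-zero coefficient). Superscripts are row indices, subscripts column indices; $d^i$ is the $i$-th row and $d_j$ the $j$-th column. Split conditions: a pair $(x_i,x_j)$ of generators in $\mathcal G$ satisfies them if SC1: $d^i_j\ne0$; SC2: $x_i\in\arg\max_{h\,\mid\, d^h_j\ne0}\mathrm{ent}(x_h)$; SC3: $x_j\in\arg\min_{h\,\mid\, d^i_h\ne0}\mathrm{ent}(x_h)$. *)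

(* Defs.v *)
From HB Require Import structures.
From mathcomp Require Import all_boot all_order all_algebra.
From mathcomp Require Import reals constructive_ereal interval_inference.
From mathcomp Require Import zify.

Set Implicit Arguments.
Unset Strict Implicit.
Unset Printing Implicit Defensive.

Import Order.TTheory GRing.Theory Num.Theory.
Local Open Scope ring_scope.

Section ChainComplexes.
Variable F : fieldType.

Record ch := Ch {
  ch_obj :> nat -> vectType F;
  ch_diff : forall n, {linear ch_obj n.+1 -> ch_obj n};
  ch_diffK : forall n x, ch_diff n (ch_diff n.+1 x) = 0;
  ch_compact : exists N : nat, forall n, (N <= n)%N -> forall x : ch_obj n, x = 0 }.

Record chmap (C D : ch) := ChMap {
  chmap_fun :> forall n, {linear C n -> D n};
  chmap_diff : forall n x,
    chmap_fun n (ch_diff C n x) = ch_diff D n (chmap_fun n.+1 x) }.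

Definition ch_iso (C D : ch) (f : chmap C D) :=
  exists g : chmap D C,
    (forall n, cancel (f n) (g n)) /\ (forall n, cancel (g n) (f n)).

Definition ch_mono (C D : ch) (f : chmap C D) := forall n, injective (f n).

Section Sum.
Variables C D : ch.

Definition pair_fun (U U' V V' : vectType F) (f : {linear U -> V})
  (g : {linear U' -> V'}) (x : U * U') : V * V' := (f x.1, g x.2).

Fact pair_fun_linear (U U' V V' : vectType F) f g :
  linear (@pair_fun U U' V V' f g).
Proof. by move=> a x y; rewrite /pair_fun /= !linearP. Qed.

HB.instance Definition _ (U U' V V' : vectType F) f g :=
  GRing.isLinear.Build F (U * U')%type (V * V')%type _ (@pair_fun U U' V V' f g)
    (@pair_fun_linear U U' V V' f g).

Definition ch_sum_obj n : vectType F := (C n * D n)%type.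

Definition ch_sum_diff n : {linear ch_sum_obj n.+1 -> ch_sum_obj n} :=
  pair_fun (ch_diff C n) (ch_diff D n).

Fact ch_sum_diffK n x : ch_sum_diff n (ch_sum_diff n.+1 x) = 0.
Proof. by case: x => x y; rewrite /ch_sum_diff /= /pair_fun /= !ch_diffK. Qed.

Fact ch_sum_compact :
  exists N : nat, forall n, (N <= n)%N -> forall x : ch_sum_obj n, x = 0.
Proof.
have [M HM] := ch_compact C; have [N HN] := ch_compact D.
exists (maxn M N) => n; rewrite geq_max => /andP[Mn Nn] [x y].
by rewrite (HM _ Mn x) (HN _ Nn y).
Qed.

Definition ch_sum := Ch ch_sum_diffK ch_sum_compact.
End Sum.

Section SumMap.
Variables (C D C' D' : ch) (f : chmap C C') (g : chmap D D').

Definition chmap_sum_fun n : {linear ch_sum C D n -> ch_sum C' D' n} :=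
  pair_fun (f n) (g n).

Fact chmap_sum_diff n x : chmap_sum_fun n (ch_diff (ch_sum C D) n x) =
  ch_diff (ch_sum C' D') n (chmap_sum_fun n.+1 x).
Proof.
by rewrite /chmap_sum_fun /= /ch_sum_diff /= /pair_fun /= !chmap_diff.
Qed.

Definition chmap_sum := ChMap chmap_sum_diff.
End SumMap.

End ChainComplexes.

Notation time R := {nonneg R}.

Section FilteredComplexes.
Variables (F : fieldType) (R : realType).

(* functors [0, +oo) -> ch; [X t n] is the degree n part at time t, X_n^t *)
Record pch := Pch {
  pch_obj :> time R -> ch F;
  trans : forall s t : time R, s <= t -> chmap (pch_obj s) (pch_obj t);
  trans_id : forall t (h : t <= t) n x, trans h n x = x;
  trans_comp : forall s t u (h1 : s <= t) (h2 : t <= u) (h3 : s <= u) n x,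
    trans h3 n x = trans h2 n (trans h1 n x) }.

(* tau lists tau_1 < ... < tau_k, the first term tau_0 = 0 being implicit *)
Definition tame (X : pch) :=
  exists2 tau : seq (time R), path <%O (0%:nng : time R) tau &
    forall (s t : time R) (h : s <= t), ~ ch_iso (trans X h) ->
      exists2 a, a \in tau & s < a <= t.

Definition filtered (X : pch) :=
  tame X /\ forall (s t : time R) (h : s <= t), ch_mono (trans X h).

Record pmap (X Y : pch) := PMap {
  pmap_fun :> forall t, chmap (X t) (Y t);
  pmap_trans : forall (s t : time R) (h : s <= t) n x,
    pmap_fun t n (trans X h n x) = trans Y h n (pmap_fun s n x) }.

Definition pch_isom (X Y : pch) :=
  exists (f : pmap X Y) (g : pmap Y X),
    (forall t n, cancel (f t n) (g t n)) /\ (forall t n, cancel (g t n) (f t n)).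

Section Sum.
Variables X Y : pch.

Definition pch_sum_trans (s t : time R) (h : s <= t) :
    chmap (ch_sum (X s) (Y s)) (ch_sum (X t) (Y t)) :=
  chmap_sum (trans X h) (trans Y h).

Fact pch_sum_id t (h : t <= t) n x : pch_sum_trans h n x = x.
Proof. by case: x => x y; rewrite /= /pair_fun /= !trans_id. Qed.

Fact pch_sum_comp s t u (h1 : s <= t) (h2 : t <= u) (h3 : s <= u) n x :
  pch_sum_trans h3 n x = pch_sum_trans h2 n (pch_sum_trans h1 n x).
Proof. by case: x => x y; rewrite /= /pair_fun /= -!trans_comp. Qed.

Definition pch_sum := Pch pch_sum_id pch_sum_comp.
End Sum.

Section IntervalSphere.
Variables (n : nat) (s : time R) (e : \bar R).

Definition isphere_dim (t : time R) (k : nat) : nat :=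
  if t < s then 0%N
  else if (t%:num%:E < e)%E then (k == n)
  else (k == n) || (k == n.+1).

Definition isphere_obj t k : vectType F := 'rV[F]_(isphere_dim t k).

(* Between spaces of dimension 0 or 1, the all-ones matrix is the identity of F
   when both dimensions are 1, and the zero map otherwise. *)
Definition isphere_map t k t' k' :
    {linear isphere_obj t k -> isphere_obj t' k'} :=
  mulmxr (const_mx 1 : 'M[F]_(isphere_dim t k, isphere_dim t' k')).

Lemma isphere_dim_le1 t k : (isphere_dim t k <= 1)%N.
Proof.
by rewrite /isphere_dim; do 2 case: ifP => // _; apply: leq_b1.
Qed.

Lemma isphere_map_comp t k t' k' t'' k'' x :
  (isphere_dim t' k' = 0%N -> isphere_dim t k = 0%N \/ isphere_dim t'' k'' = 0%N) ->
  isphere_map t' k' t'' k'' (isphere_map t k t' k' x) = isphere_map t k t'' k'' x.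
Proof.
rewrite /isphere_map /= -mulmxA => H; congr (_ *m _).
apply/matrixP => a b; rewrite !mxE.
have := isphere_dim_le1 t' k'; move: H.
case: (isphere_dim t' k') => [|[|//]] H _; last first.
  by rewrite big_ord1 !mxE mulr1.
by case: (H erefl) => E; [case: a|case: b] => ? /[dup]; rewrite {1}E.
Qed.

Lemma isphere_map0 t k t' k' x :
  isphere_dim t k = 0%N \/ isphere_dim t' k' = 0%N -> isphere_map t k t' k' x = 0.
Proof.
rewrite /isphere_map /= => H; apply/rowP => b; rewrite !mxE.
case: H => E; last by case: b => ? /[dup]; rewrite {1}E.
by rewrite big1 // => -[? /[dup]]; rewrite {1}E.
Qed.

Lemma isphere_dim_mono t t' k :
  t <= t' -> isphere_dim t' k = 0%N -> isphere_dim t k = 0%N.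
Proof.
rewrite /isphere_dim => tt'; case: (ltP t s) => // st.
rewrite ltNge (le_trans st tt') /=.
case: ifP => [lt' | _].
  by rewrite (@Order.POrderTheory.le_lt_trans _ _ t'%:num%:E) ?lee_fin.
by case: (k == n) => //; case: ifP => //.
Qed.


Lemma isphere_dim_supp t k :
  isphere_dim t k <> 0%N -> k = n \/ k = n.+1.
Proof.
rewrite /isphere_dim; case: ifP => // _; case: ifP => _.
  by case: eqP => // ->; left.
by case: eqP => [->|_]; [left|case: eqP => // ->; right].
Qed.

Fact isphere_diffK t k x :
  isphere_map t k.+1 t k (isphere_map t k.+2 t k.+1 x) = 0.
Proof.
have [H|/eqP H] := eqVneq (isphere_dim t k.+2) 0%N.
  by rewrite [isphere_map _ k.+2 _ _ _]isphere_map0 ?linear0; [|left].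
rewrite isphere_map0 //; right; apply/eqP/negPn/negP => /eqP H'.
by have := isphere_dim_supp H; have := isphere_dim_supp H'; lia.
Qed.

Fact isphere_compact t :
  exists N : nat, forall k, (N <= k)%N -> forall x : isphere_obj t k, x = 0.
Proof.
exists n.+2 => k kn x; apply/rowP => a.
have [H|/eqP H] := eqVneq (isphere_dim t k) 0%N.
  by case: a => ? /[dup]; rewrite {1}H.
by have := isphere_dim_supp H; lia.
Qed.

Definition isphere_ch t : ch F := Ch (@isphere_diffK t) (isphere_compact t).

Fact isphere_trans_diff (t t' : time R) (h : t <= t') k x :
  isphere_map t k t' k (isphere_map t k.+1 t k x) =
  isphere_map t' k.+1 t' k (isphere_map t k.+1 t' k.+1 x).
Proof.
rewrite !isphere_map_comp => [//|/(isphere_dim_mono h)|H0]; first by left.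
have [H|/eqP H] := eqVneq (isphere_dim t k.+1) 0%N; [by left|right].
have [//|/eqP H'] := eqVneq (isphere_dim t' k) 0%N.
case: (isphere_dim_supp H) => kn.
  by have := isphere_dim_supp H'; lia.
case: kn => kn; move: H0 H; rewrite /isphere_dim kn eqxx /=.
by case: ifP => // _; case: ifP.
Qed.

Definition isphere_trans (t t' : time R) (h : t <= t') :
    chmap (isphere_ch t) (isphere_ch t') :=
  @ChMap _ (isphere_ch t) (isphere_ch t') (fun k => isphere_map t k t' k)
    (isphere_trans_diff h).

Fact isphere_trans_id t (h : t <= t) k x : isphere_trans h k x = x.
Proof.
rewrite /= /isphere_map /=; apply/rowP => a; rewrite mxE (bigD1 a) //= mxE mulr1.
rewrite big1 ?addr0 // => b /eqP[]; apply: val_inj => /=.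
have := isphere_dim_le1 t k; case: (isphere_dim t k) a b {x} => [|[|//]] a b _;
  by case: a b => [[|?] // ?] [[|?] // ?].
Qed.

Fact isphere_trans_comp t u v (h1 : t <= u) (h2 : u <= v) (h3 : t <= v) k x :
  isphere_trans h3 k x = isphere_trans h2 k (isphere_trans h1 k x).
Proof.
by symmetry; apply: isphere_map_comp => /(isphere_dim_mono h1); left.
Qed.

(* the interval sphere I^n[s, e) *)
Definition isphere : pch := Pch isphere_trans_id isphere_trans_comp.
End IntervalSphere.

Section Generators.
Variable X : pch.

Record gen := Gen { deg : nat; ent : time R; elt : X ent deg }.

(* the image of the generator x in X_n^t, if n = deg x and ent x <= t;
   0 otherwise *)
Definition push (x : gen) (n : nat) (t : time R) : X t n :=
  match deg x =P n, @idP (ent x <= t) with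
  | ReflectT e, ReflectT h =>
      trans X h n (ecast k (X (ent x) k) e (elt x))
  | _, _ => 0
  end.

(* the image in X_n^t of the differential of x *)
Definition bdry (x : gen) (n : nat) (t : time R) : X t n :=
  ch_diff (X t) n (push x n.+1 t).

Lemma pushE x t (h : ent x <= t) : push x (deg x) t = trans X h (deg x) (elt x).
Proof.
rewrite /push; case: eqP => // e; rewrite (eq_irrelevance e erefl) /=.
by case: {-}_ / idP => // h'; rewrite (bool_irrelevance h' h).
Qed.

Lemma push_ent x : push x (deg x) (ent x) = elt x.
Proof. by rewrite (pushE (lexx _)) trans_id. Qed.

Lemma push_deg x n t : deg x != n -> push x n t = 0.
Proof. by rewrite /push; case: eqP. Qed.

Lemma push_lt x n t : t < ent x -> push x n t = 0.
Proof.
move=> lt; rewrite /push; case: eqP => // e.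
by case: {-}_ / idP => // h; suff: false by []; have := h; rewrite leNgt lt.
Qed.

Lemma trans_push x n s t (h : s <= t) : ent x <= s ->
  trans X h n (push x n s) = push x n t.
Proof.
move=> xs; case: (deg x =P n) => [<-|/eqP ne]; last by rewrite !push_deg ?linear0.
by rewrite (pushE xs) (pushE (le_trans xs h)); apply/esym/trans_comp.
Qed.

Section Family.
Variables (m : nat) (G : 'I_m -> gen).

Definition gen_span (n : nat) (t : time R) : {vspace X t n} :=
  (<<[seq push (G k) n t | k <- enum 'I_m] ++
     [seq bdry (G k) n t | k <- enum 'I_m]>>)%VS.

Definition generates := forall n t, gen_span n t = fullv.

End Family.

(* rad X_n at t: the sum of the images of X_n^{s < t} over all s < t *)
Definition rad (n : nat) (t : time R) (v : X t n) : Prop :=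
  exists (q : nat) (s : 'I_q -> time R) (lt_st : forall a, s a < t)
         (u : forall a, X (s a) n),
    v = \sum_a trans X (ltW (lt_st a)) n (u a).

End Generators.

(* The classes modulo W of the b k with P k form a basis of V / W. *)
Definition basis_mod (V : vectType F) (W : V -> Prop) (I : finType)
    (P : pred I) (b : I -> V) :=
  (forall v, exists c : I -> F, W (v - \sum_(k | P k) c k *: b k)) /\
  (forall c : I -> F, W (\sum_(k | P k) c k *: b k) ->
     forall k, P k -> c k = 0).

Section Families.
Variables (X : pch) (m : nat) (G : 'I_m -> gen X).

Definition quasi_minimal := generates G /\
  forall n t, basis_mod (@rad X n t)
    [pred k | (deg (G k) == n) && (ent (G k) == t)] (fun k => push (G k) n t).

(* The first clause is a single equation, in degree deg (G j) - 1; in the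
   other degrees both sides vanish. *)
Definition total_boundary_matrix (d : 'M[F]_m) :=
  (forall j n, bdry (G j) n (ent (G j)) =
     \sum_i d i j *: push (G i) n (ent (G j))) /\
  (forall i j, d i j != 0 ->
     deg (G j) = (deg (G i)).+1 /\ ent (G i) <= ent (G j)).

Definition argmax_ent (P : pred 'I_m) : {set 'I_m} :=
  [set i | P i & [forall h, P h ==> (ent (G h) <= ent (G i))]].

Definition argmin_ent (P : pred 'I_m) : {set 'I_m} :=
  [set i | P i & [forall h, P h ==> (ent (G i) <= ent (G h))]].

Definition split_conditions (d : 'M[F]_m) (i j : 'I_m) :=
  [/\ d i j != 0,
      i \in argmax_ent [pred h | d h j != 0] &
      j \in argmin_ent [pred h | d i h != 0]].

End Families.

Section Generated.
Variables (X : pch) (m : nat) (G : 'I_m -> gen X).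

Local Notation U := (gen_span G).

Lemma gen_span_diff n t (x : X t n.+1) :
  x \in U n.+1 t -> ch_diff (X t) n x \in U n t.
Proof.
have -> : (ch_diff (X t) n x = linfun (ch_diff (X t) n) x) by rewrite lfunE.
move=> xU; have := memv_img (linfun (ch_diff (X t) n)) xU.
apply: subvP; rewrite limg_span; apply/span_subvP => y; rewrite map_cat mem_cat.
case/orP => /mapP[z /mapP[k _ ->] ->]; rewrite lfunE /=.
  apply: memv_span; rewrite mem_cat; apply/orP; right.
  by apply/mapP; exists k; rewrite ?mem_enum.
by rewrite /bdry ch_diffK mem0v.
Qed.

Lemma gen_span_trans n s t (h : s <= t) (x : X s n) :
  x \in U n s -> trans X h n x \in U n t.
Proof.
have -> : (trans X h n x = linfun (trans X h n) x) by rewrite lfunE.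
move=> xU; have := memv_img (linfun (trans X h n)) xU.
apply: subvP; rewrite limg_span; apply/span_subvP => y; rewrite map_cat mem_cat.
have mem0 : 0 \in U n t by exact: mem0v.
case/orP => /mapP[z /mapP[k _ ->] ->]; rewrite lfunE /= ?/bdry ?chmap_diff;
  have [ks|ks] := leP (ent (G k)) s; rewrite ?(push_lt _ ks) ?linear0 //
    trans_push //; apply: memv_span; rewrite mem_cat; apply/orP.
- by left; rewrite map_f ?mem_enum.
- by right; apply/mapP; exists k; rewrite ?mem_enum.
Qed.

Definition generated_obj t n : vectType F := subvs_of (U n t).

Definition generated_diff t n : {linear generated_obj t n.+1 -> generated_obj t n} :=
  vsproj (U n t) \o (ch_diff (X t) n \o vsval).

Fact generated_diffK t n x : generated_diff t n (generated_diff t n.+1 x) = 0.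
Proof.
rewrite /= vsprojK ?gen_span_diff ?subvsP // ch_diffK.
by rewrite linear0.
Qed.

Fact generated_compact t :
  exists N : nat, forall n, (N <= n)%N -> forall x : generated_obj t n, x = 0.
Proof.
have [N HN] := ch_compact (X t); exists N => n Nn x.
by apply: val_inj; rewrite [LHS](HN n Nn) [RHS](HN n Nn).
Qed.

Definition generated_ch t := Ch (@generated_diffK t) (generated_compact t).

Definition generated_trans_fun s t (h : s <= t) n :
    {linear generated_obj s n -> generated_obj t n} :=
  vsproj (U n t) \o (trans X h n \o vsval).

Fact generated_trans_diff s t (h : s <= t) n x :
  generated_trans_fun h n (generated_diff s n x) =
  generated_diff t n (generated_trans_fun h n.+1 x).
Proof.
by rewrite /= !vsprojK ?gen_span_diff ?gen_span_trans ?subvsP // chmap_diff.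
Qed.

Definition generated_trans s t (h : s <= t) :
    chmap (generated_ch s) (generated_ch t) :=
  @ChMap _ (generated_ch s) (generated_ch t) (generated_trans_fun h)
    (generated_trans_diff h).

Fact generated_trans_id t (h : t <= t) n x : generated_trans h n x = x.
Proof. by rewrite /= trans_id vsvalK. Qed.

Fact generated_trans_comp s t u (h1 : s <= t) (h2 : t <= u) (h3 : s <= u) n x :
  generated_trans h3 n x = generated_trans h2 n (generated_trans h1 n x).
Proof.
by rewrite /= vsprojK ?gen_span_trans ?subvsP // -trans_comp.
Qed.

(* the subcomplex of X generated by G, with the restricted differential *)
Definition generated : pch := Pch generated_trans_id generated_trans_comp.

Lemma elt_gen_span k : elt (G k) \in U (deg (G k)) (ent (G k)).
Proof.
rewrite -push_ent memv_span // mem_cat; apply/orP; left.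
by apply/mapP; exists k; rewrite ?mem_enum.
Qed.

(* the elements of G, regarded as elements of the subcomplex they generate *)
Definition generated_gen (k : 'I_m) : gen generated :=
  @Gen generated (deg (G k)) (ent (G k)) (Subvs (elt_gen_span k)).

End Generated.
End FilteredComplexes.

Section Removal.
Variables (m : nat) (i j : 'I_m).

Definition kept : {set 'I_m} := ~: [set i; j].

Lemma card_kept : i != j -> #|kept| = (m - 2)%N.
Proof. by move=> ij; rewrite /kept cardsCs setCK cards2 ij card_ord. Qed.

(* [enum_val] is increasing on ordinals, so the original order is preserved. *)
Definition remove_fam (T : Type) (G : 'I_m -> T) : 'I_#|kept| -> T :=
  fun k => G (enum_val k).

Definition remove_mx (T : Type) (d : 'M[T]_m) : 'M[T]_#|kept| :=
  mxsub enum_val enum_val d.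

Definition clear_rows (F : fieldType) (d : 'M[F]_m) : 'M[F]_m :=
  \matrix_k (if d k j != 0
             then row k d + (- ((d i j)^-1 * d k j)) *: row i d
             else row k d).

End Removal.

Arguments remove_fam {m} i j {T} G k.
Arguments remove_mx {m} i j {T} d.
Arguments clear_rows {m} i j {F} d.

(* Main.v *)
(** The new generators are [δ x_j] in place of [x_i], [x_j] itself, and
    [x_k - (d^i_j)^-1 d^i_k x_j] in place of every other [x_k].  SC2 makes the
    first replacement compatible with degrees and entrance times, SC3 the last
    one.  Removing [x_j] from the [x_k] is necessary: otherwise [δ x_k] could
    involve [x_i], and the subcomplex generated by the remaining generators
    would not be a complement.  After the change of basis [δ x_j = x_i] and
    [δ x_i = 0], and no other boundary involves [x_i]; since [δ δ = 0], no
    boundary involves [x_j] either.  Hence both the pair and the remaining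
    generators span subcomplexes, and the former is an interval sphere. *)
From HB Require Import structures.
Require Import Defs.
From mathcomp Require Import all_boot all_order all_algebra.
From mathcomp Require Import reals constructive_ereal interval_inference.

Import Order.TTheory GRing.Theory Num.Theory.
Local Open Scope ring_scope.

(** * Inverting degreewise bijective maps *)

Section Combinations.
Set Implicit Arguments.
Unset Strict Implicit.
Variables (F : fieldType) (R : realType).
Implicit Types (X : pch F R) (n : nat) (s t : time R).

Lemma sum_neq0 (V : nmodType) (I : finType) (P : pred I) (f : I -> V) :
  \sum_(k | P k) f k != 0 -> exists2 k, P k & f k != 0.
Proof.
case: (pickP (fun k => P k && (f k != 0))) => [k /andP[]|f0]; first by exists k.
rewrite big1 ?eqxx // => k Pk; apply/eqP.
by move/negbT: (f0 k); rewrite Pk /= negbK.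
Qed.

(** The degreewise inverse commutes with the differentials because the given map does. It is
    returned as data, so that [bij_pch_isom] can collect the inverses at all times into one map. *)
Lemma chmap_inv (C D : ch F) (f : chmap C D) :
  (forall n, injective (f n)) -> (forall n y, exists x, f n x = y) ->
  {g : chmap D C | (forall n, cancel (f n) (g n)) & (forall n, cancel (g n) (f n))}.
Proof.
move=> inj surj; pose g n : {linear D n -> C n} := ((linfun (f n))^-1)%VF.
have fK n : cancel (f n) (g n).
  move=> x; have /lker0_lfunK K : lker (linfun (f n)) == 0%VS.
    by apply/lker0P => y z; rewrite !lfunE => /inj.
  by have := K x; rewrite lfunE.
have gK n : cancel (g n) (f n).
  by move=> y; have [x <-] := surj n y; rewrite fK.
have gd n x : g n (ch_diff D n x) = ch_diff C n (g n.+1 x).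
  by apply: inj; rewrite gK chmap_diff gK.
by exists (ChMap gd).
Qed.

Lemma bij_ch_iso (C D : ch F) (f : chmap C D) :
  (forall n, injective (f n)) -> (forall n y, exists x, f n x = y) -> ch_iso f.
Proof. by move=> inj surj; have [g fK gK] := chmap_inv inj surj; exists g. Qed.

Lemma bij_pch_isom (X Y : pch F R) (f : Defs.pmap X Y) :
  (forall t n, injective (f t n)) -> (forall t n y, exists x, f t n x = y) ->
  pch_isom X Y.
Proof.
move=> inj surj; pose g t := s2val (chmap_inv (inj t) (surj t)).
have fK t n : cancel (f t n) (g t n) := s2valP (chmap_inv (inj t) (surj t)) n.
have gK t n : cancel (g t n) (f t n) := s2valP' (chmap_inv (inj t) (surj t)) n.
have gt s t (h : s <= t) n x : g t n (trans Y h n x) = trans X h n (g s n x).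
  by apply: (inj t n); rewrite gK pmap_trans gK.
by exists f, (PMap gt).
Qed.

Lemma pch_isom_sym (X Y : pch F R) : pch_isom X Y -> pch_isom Y X.
Proof. by move=> [f [g [fK gK]]]; exists g, f. Qed.

(** * Closure properties of the radical *)

Lemma rad0 X n t : Defs.rad (0 : X t n).
Proof.
exists 0%N, (fun=> t); unshelve eexists; first by case.
by exists (fun=> 0); rewrite big_ord0.
Qed.

(** The two lists of earlier times are concatenated. The space containing each vector depends on its
    time, hence the dependent match in [U]. *)
Lemma radD X n t (v w : X t n) : Defs.rad v -> Defs.rad w -> Defs.rad (v + w).
Proof.
move=> [q [s [lt [u ->]]]] [q' [s' [lt' [u' ->]]]].
pose S a := match split a with inl b => s b | inr b => s' b end.
have LT a : S a < t by rewrite /S; case: (split a).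
pose U a : X (S a) n :=
  match split a as z return X (match z with inl b => s b | inr b => s' b end) n with
  | inl b => u b | inr b => u' b end.
exists (q + q')%N, S, LT, U; rewrite big_split_ord /=.
congr (_ + _); apply: eq_bigr => b _.
  have : split (lshift q' b) = inl b by exact: (unsplitK (inl b)).
  move: (LT _); rewrite /U /S; case: (split _) => // ? h [E]; move: h; rewrite E => h.
  by rewrite (bool_irrelevance h (lt b)).
have : split (rshift q b) = inr b by exact: (unsplitK (inr b)).
move: (LT _); rewrite /U /S; case: (split _) => // ? h [E]; move: h; rewrite E => h.
by rewrite (bool_irrelevance h (lt' b)).
Qed.

Lemma radZ X n t a (v : X t n) : Defs.rad v -> Defs.rad (a *: v).
Proof.
move=> [q [s [lt [u ->]]]]; exists q, s, lt, (fun b => a *: u b).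
by rewrite scaler_sumr; apply: eq_bigr => b _; rewrite linearZ.
Qed.

Lemma radN X n t (v : X t n) : Defs.rad v -> Defs.rad (- v).
Proof. by rewrite -scaleN1r; apply: radZ. Qed.

Lemma rad_trans X n s t (lt : s < t) (v : X s n) : Defs.rad (trans X (ltW lt) n v).
Proof. by exists 1%N, (fun=> s), (fun=> lt), (fun=> v); rewrite big_ord1. Qed.

Lemma rad_sum X n t (I : finType) (P : pred I) (f : I -> X t n) :
  (forall k, P k -> Defs.rad (f k)) -> Defs.rad (\sum_(k | P k) f k).
Proof.
by move=> radf; apply: big_ind => //; [apply: rad0 | apply: radD].
Qed.

(** * Coordinates with respect to a family of generators *)

Section Family.
Variables (X : pch F R) (m : nat) (G : 'I_m -> gen X).

Definition comb n t (c : 'cV[F]_m) : X t n := \sum_k c k 0 *: push (G k) n t.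

(* Only the generators with [deg = n] and [ent <= t] have a meaningful [push];
   the others are sent to the junk value [0], so their coefficients must vanish
   for coordinates to be unique. *)
Definition alive n t (c : 'cV[F]_m) :=
  forall k, c k 0 != 0 -> deg (G k) = n /\ ent (G k) <= t.

(** The dropped coefficients multiply zero images only, so truncation makes every column alive
    without changing its combination. *)
Definition trunc n t (c : 'cV[F]_m) : 'cV[F]_m :=
  \col_k (if (deg (G k) == n) && (ent (G k) <= t) then c k 0 else 0).

(** Together with [independent], this says that the generators of degree [n] entering by time [t]
    give a basis of [X t n]; quasi-minimality is used below in this form. *)
Definition spanning := forall n t (v : X t n), exists2 c, alive n t c & v = comb n t c.

Definition independent := forall n t c, alive n t c -> comb n t c = 0 -> c = 0.

Lemma combD n t c c' : comb n t (c + c') = comb n t c + comb n t c'.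
Proof. by rewrite -big_split; apply: eq_bigr => k _; rewrite mxE scalerDl. Qed.

Lemma combZ n t a c : comb n t (a *: c) = a *: comb n t c.
Proof. by rewrite scaler_sumr; apply: eq_bigr => k _; rewrite mxE scalerA. Qed.

Lemma comb0 n t : comb n t 0 = 0.
Proof. by rewrite [LHS]big1 // => k _; rewrite mxE scale0r. Qed.

Lemma comb_delta n t k : comb n t (delta_mx k 0) = push (G k) n t.
Proof.
rewrite /comb (bigD1 k) //= mxE !eqxx scale1r big1 ?addr0 // => l /negbTE lk.
by rewrite mxE lk scale0r.
Qed.

Lemma aliveD n t c c' : alive n t c -> alive n t c' -> alive n t (c + c').
Proof.
move=> ac ac' k; rewrite mxE; have [c0|c0 _] := eqVneq (c k 0) 0.
  by rewrite c0 add0r => /ac'.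
exact: ac.
Qed.

Lemma aliveZ n t a c : alive n t c -> alive n t (a *: c).
Proof. by move=> ac k; rewrite mxE mulf_eq0 negb_or => /andP[_ /ac]. Qed.

Lemma alive_delta k : alive (deg (G k)) (ent (G k)) (delta_mx k 0).
Proof.
by move=> l; rewrite mxE eqxx andbT; have [->|] := eqVneq l k; rewrite ?lexx ?eqxx.
Qed.

Lemma alive_trunc n t c : alive n t (trunc n t c).
Proof. by move=> k; rewrite mxE; case: ifP => [/andP[/eqP -> ->]|]; rewrite ?eqxx. Qed.

Lemma push_dead k n t : ~~ ((deg (G k) == n) && (ent (G k) <= t)) ->
  push (G k) n t = 0.
Proof.
by rewrite negb_and -ltNge => /orP[/push_deg|/push_lt] ->.
Qed.

Lemma comb_trunc n t c : comb n t (trunc n t c) = comb n t c.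
Proof.
apply: eq_bigr => k _; rewrite mxE; case: ifP => // /negbT /push_dead ->.
by rewrite !scaler0.
Qed.

Lemma trans_comb n s t (h : s <= t) c :
  alive n s c -> trans X h n (comb n s c) = comb n t c.
Proof.
move=> ac; rewrite /comb linear_sum; apply: eq_bigr => k _; rewrite linearZ /=.
have [-> |/ac[_ ks]] := eqVneq (c k 0) 0; first by rewrite !scale0r.
by rewrite trans_push.
Qed.

(** These are the admissible changes of generators: column [k] describes an element of the degree of
    [G k] that exists when [G k] enters. *)
Definition graded (P : 'M[F]_m) :=
  forall k, alive (deg (G k)) (ent (G k)) (col k P).

Lemma gradedP P h k : graded P -> P h k != 0 ->
  deg (G h) = deg (G k) /\ ent (G h) <= ent (G k).
Proof. by move=> gP Phk; apply: gP; rewrite mxE. Qed.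

Lemma alive_mul P n t c : graded P -> alive n t c -> alive n t (P *m c).
Proof.
move=> gP ac h; rewrite mxE => /sum_neq0[k _].
rewrite mulf_eq0 negb_or => /andP[/(gradedP gP)[-> hk] /ac[-> kt]].
by split=> //; apply: le_trans hk kt.
Qed.

Lemma graded1 : graded 1%:M.
Proof. by move=> k; rewrite col1; apply: alive_delta. Qed.

Lemma gradedD P Q : graded P -> graded Q -> graded (P + Q).
Proof. by move=> gP gQ k; rewrite linearD; apply: aliveD. Qed.

Lemma gradedZ a P : graded P -> graded (a *: P).
Proof. by move=> gP k; rewrite linearZ; apply: aliveZ. Qed.

(** * The differential in coordinates *)

Section Boundary.
Variables (d : 'M[F]_m) (Gd : total_boundary_matrix G d).

Lemma bdryE k n t :
  bdry (G k) n t = if ent (G k) <= t then comb n t (col k d) else 0.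
Proof.
case: leP => [kt|tk]; last by rewrite /bdry push_lt ?linear0.
rewrite /bdry -(trans_push _ kt) // -chmap_diff -/(bdry _ _ _) (proj1 Gd).
rewrite linear_sum; apply: eq_bigr => h _; rewrite linearZ mxE /=.
have [-> |/(proj2 Gd)[_ ?]] := eqVneq (d h k) 0; first by rewrite !scale0r.
by rewrite trans_push.
Qed.

Lemma alive_bdry n t c : alive n.+1 t c -> alive n t (d *m c).
Proof.
move=> ac h; rewrite mxE => /sum_neq0[k _].
rewrite mulf_eq0 negb_or => /andP[/(proj2 Gd)[dk hk] /ac[]].
by rewrite dk => -[->] kt; split=> //; apply: le_trans hk kt.
Qed.

Lemma diff_comb n t c : alive n.+1 t c ->
  ch_diff (X t) n (comb n.+1 t c) = comb n t (d *m c).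
Proof.
move=> ac; transitivity (\sum_k c k 0 *: comb n t (col k d)).
  rewrite /comb linear_sum; apply: eq_bigr => k _; rewrite linearZ /= -/(bdry _ _ _).
  have [-> |/ac[_ kt]] := eqVneq (c k 0) 0; first by rewrite !scale0r.
  by rewrite bdryE kt.
under eq_bigr do rewrite scaler_sumr.
rewrite exchange_big; apply: eq_bigr => h _; rewrite mxE scaler_suml.
by apply: eq_bigr => k _; rewrite mxE scalerA mulrC.
Qed.

Lemma tbm_sqr : independent -> d *m d = 0.
Proof.
move=> ind; apply/matrixP => g k; rewrite [RHS]mxE.
apply/eqP/negPn/negP => /[dup] /[!mxE] /sum_neq0[h _].
rewrite mulf_eq0 negb_or => /andP[/(proj2 Gd)[dh _] /(proj2 Gd)[dk _]].
(* A non-zero entry at [(g, k)] makes [deg (G k)] equal to [deg (G g)] plus 2, so the differential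
   can be applied twice to [G k] and independence used in degree [deg (G g)]. *)
have: d *m (d *m delta_mx k (0 : 'I_1)) = 0.
  apply: (ind (deg (G g)) (ent (G k))).
    by do 2 apply: alive_bdry; rewrite -dh -dk; apply: alive_delta.
  rewrite -diff_comb -?diff_comb ?ch_diffK //.
    by rewrite -dh -dk; apply: alive_delta.
  by apply: alive_bdry; rewrite -dh -dk; apply: alive_delta.
rewrite mulmxA -colE => /matrixP/(_ g 0).
by rewrite !mxE => ->; rewrite eqxx.
Qed.

(** By the total boundary matrix every boundary is itself a combination of generators, so
    coordinates on the generators describe all of [gen_span]. *)
Lemma spanP n t (v : X t n) :
  reflect (exists2 c, alive n t c & v = comb n t c) (v \in gen_span G n t).
Proof.
apply: (iffP idP) => [|[c _ ->]]; last first.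
  apply: memv_suml => k _; apply/memvZ/memv_span.
  by rewrite mem_cat map_f ?mem_enum.
suff /subvP sub : (gen_span G n t <= <<mktuple (fun k => push (G k) n t)>>)%VS.
  move/sub/coord_span => ->.
  exists (trunc n t (\col_k coord (mktuple (fun k => push (G k) n t)) k v)).
    exact: alive_trunc.
  rewrite comb_trunc; apply: eq_bigr => k _.
  by rewrite mxE -tnth_nth tnth_mktuple.
have mem k : push (G k) n t \in <<mktuple (fun k => push (G k) n t)>>%VS.
  by apply/memv_span/mapP; exists k; rewrite ?mem_enum.
apply/span_subvP => x; rewrite mem_cat => /orP[] /mapP[k _ ->] //.
rewrite bdryE; case: ifP => _; last exact: mem0v.
by apply: memv_suml => h _; apply: memvZ.
Qed.

End Boundary.

(** * Quasi-minimal families as bases, and tameness *)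

(* The largest entrance time carrying a nonzero coefficient would give a
   relation modulo the radical. *)
Lemma qmin_independent :
  (forall s t (h : s <= t), ch_mono (trans X h)) -> quasi_minimal G -> independent.
Proof.
move=> mono [_ qm] n t c ac c0; apply/eqP/negPn/negP => /matrix0Pn[k0 [z ck0]].
rewrite {z}[z]ord1 in ck0.
have [k ck kmax] := @arg_maxP _ _ _ k0 [pred k | c k 0 != 0] (fun k => ent (G k)) ck0.
have [dk kt] := ac _ ck.
have as_ : alive n (ent (G k)) c.
  by move=> h ch; split; [case: (ac _ ch) | apply: kmax].
(* Injectivity of the transition brings the relation back to the entrance time of [G k], where every
   generator that entered strictly earlier lies in the radical. *)
have: comb n (ent (G k)) c = 0.
  by apply: (mono _ _ kt n); rewrite trans_comb // linear0.
rewrite /comb (bigID [pred h | (deg (G h) == n) && (ent (G h) == ent (G k))]) /=.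
move/eqP; rewrite addr_eq0 => /eqP E.
suff W : Defs.rad (- \sum_(h | ~~ ((deg (G h) == n) && (ent (G h) == ent (G k))))
                      c h 0 *: push (G h) n (ent (G k))).
  have [_ /(_ (fun h => c h 0))] := qm n (ent (G k)).
  rewrite /= E => /(_ W k); rewrite dk !eqxx => /(_ isT) ck0'.
  by rewrite /= ck0' eqxx in ck.
apply/radN/rad_sum => h dh; apply: radZ.
have [/eqP dh' |/push_deg ->] := boolP (deg (G h) == n); last exact: rad0.
have [hk|kh] := leP (ent (G h)) (ent (G k)); last by rewrite push_lt //; apply: rad0.
have lt : ent (G h) < ent (G k) by rewrite lt_neqAle hk andbT; rewrite dh' eqxx in dh.
by rewrite -(trans_push n (ltW lt)) //; apply: rad_trans.
Qed.

(** Each summand comes from some time before [t], and its coordinates there involve only generators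
    already present. *)
Lemma rad_comb n t v : spanning -> Defs.rad v ->
  exists2 c, v = comb n t c & forall k, c k 0 != 0 -> ent (G k) < t.
Proof.
move=> sp [q [s [lt [u ->]]]]; elim: q => [|q IH] in s lt u *.
  by exists 0; [rewrite big_ord0 comb0 | move=> k; rewrite mxE eqxx].
have [c E cP] := IH _ (fun a => lt (lift ord0 a)) (fun a => u (lift ord0 a)).
have [c' ac' E'] := sp _ _ (u ord0).
exists (c' + c) => [|k]; first by rewrite big_ord_recl E' trans_comb // E combD.
rewrite mxE; have [c0|c0 _] := eqVneq (c' k 0) 0; first by rewrite c0 add0r => /cP.
by apply: le_lt_trans (lt ord0); case: (ac' k).
Qed.

(** Modulo the radical only generators entering exactly at [t] survive. A relation among these would
    express them through strictly earlier generators, against independence. *)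
Lemma basis_qmin : spanning -> independent -> quasi_minimal G.
Proof.
move=> sp ind; split=> [n t|n t].
  apply/vspaceP => v; rewrite memvf; have [c _ ->] := sp _ _ v.
  by apply: memv_suml => k _; apply/memvZ/memv_span; rewrite mem_cat map_f ?mem_enum.
split=> [v|c W k /= /andP[/eqP dk /eqP ek]].
  have [c ac ->] := sp _ _ v; exists (fun k => c k 0).
  rewrite /comb (bigID [pred k | (deg (G k) == n) && (ent (G k) == t)]) /=.
  rewrite addrAC subrr add0r; apply: rad_sum => k; rewrite negb_and.
  have [-> _|ck] := eqVneq (c k 0) 0; first by rewrite scale0r; apply: rad0.
  have [-> kt] := ac _ ck; rewrite eqxx /= => ne.
  have lt : ent (G k) < t by rewrite lt_neqAle ne.
  by rewrite -(trans_push n (ltW lt)) //; apply/radZ/rad_trans.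
have [c' E cP'] := rad_comb sp W.
pose c1 : 'cV[F]_m := \col_k (if (deg (G k) == n) && (ent (G k) == t) then c k else 0).
have Ec1 : comb n t c1 = comb n t c'.
  rewrite -E [RHS]big_mkcond; apply: eq_bigr => h _; rewrite mxE /=.
  by case: ifP; rewrite ?scale0r.
(* [c'] is not known to be alive, so independence is applied to a truncation; this keeps the entry
   at [k]. *)
have: trunc n t (c1 - c') = 0.
  apply: (ind n t); first exact: alive_trunc.
  by rewrite comb_trunc combD -scaleN1r combZ Ec1 scaleN1r subrr.
move/matrixP/(_ k 0); rewrite !mxE dk ek !eqxx lexx /=.
have [->|/cP'] := eqVneq (c' k 0) 0; first by rewrite subr0.
by rewrite ek ltxx.
Qed.

(** If no generator enters after [s] and by [t], coordinates at [t] are also coordinates at [s], so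
    the transition is onto. *)
Lemma spanning_tame : spanning ->
  (forall s t (h : s <= t), ch_mono (trans X h)) -> tame X.
Proof.
move=> sp mono.
(* Entrance time 0 is filtered out because the list must increase strictly from the implicit first
   term 0; no [s] lies below 0 anyway. *)
exists [seq x <- sort <=%O (undup [seq ent (G k) | k <- enum 'I_m]) | 0%:nng < x].
  rewrite path_sortedE; last by move=> y x z; apply: lt_trans.
  rewrite filter_all sorted_filter ?sort_lt_sorted ?undup_uniq //; by move=> y x z; apply: lt_trans.
move=> s t h niso; apply/hasP; apply/negPn/negP => /hasPn no; apply: niso.
apply: bij_ch_iso => [n|n v]; first exact: mono.
have [c ac ->] := sp _ _ v; exists (comb n s c); apply: trans_comb => k ck.
have [-> kt] := ac _ ck; split=> //; rewrite leNgt; apply/negP => sk.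
have : ent (G k) \in [seq x <- sort <=%O (undup [seq ent (G k) | k <- enum 'I_m]) | 0%:nng < x].
  rewrite mem_filter mem_sort mem_undup map_f ?mem_enum // andbT.
  by apply: le_lt_trans sk; rewrite -num_le /=.
by move/no; rewrite sk kt.
Qed.

End Family.

(** * Changing generators by an invertible graded matrix *)

Section ChangeOfBasis.
Variables (X : pch F R) (m : nat) (G : 'I_m -> gen X) (P Q d : 'M[F]_m).
Hypotheses (gP : graded G P) (gQ : graded G Q) (PQ : P *m Q = 1%:M).

Definition change_gens k : gen X :=
  @Gen F R X (deg (G k)) (ent (G k)) (comb G (deg (G k)) (ent (G k)) (col k P)).

Lemma push_change_gens k n t : ent (G k) <= t ->
  push (change_gens k) n t = comb G n t (col k P).
Proof.
move=> kt; case: (deg (G k) =P n) => [<-|/eqP ne].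
  exact: etrans (@pushE _ _ _ (change_gens k) t kt) (trans_comb kt (@gP k)).
rewrite push_deg //; apply/esym/big1 => h _.
have [->|/gP[E _]] := eqVneq (col k P h 0) 0; first by rewrite scale0r.
by rewrite push_deg ?scaler0 // E.
Qed.

Lemma change_gens_id k : col k P = delta_mx k 0 -> change_gens k = G k.
Proof.
by rewrite /change_gens => ->; rewrite comb_delta push_ent; case: (G k).
Qed.

Lemma comb_change_gens n t c : alive G n t c ->
  comb change_gens n t c = comb G n t (P *m c).
Proof.
move=> ac; transitivity (\sum_k c k 0 *: comb G n t (col k P)).
  apply: eq_bigr => k _.
  have [-> |/ac[_ kt]] := eqVneq (c k 0) 0; first by rewrite !scale0r.
  by rewrite push_change_gens.
under eq_bigr do rewrite scaler_sumr.
rewrite exchange_big; apply: eq_bigr => h _; rewrite mxE scaler_suml.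
by apply: eq_bigr => k _; rewrite mxE scalerA mulrC.
Qed.

Lemma change_gens_spanning : spanning G -> spanning change_gens.
Proof.
move=> sp n t v; have [c ac ->] := sp n t v.
have aQ := alive_mul gQ ac.
by exists (Q *m c) => //; rewrite comb_change_gens // mulmxA PQ mul1mx.
Qed.

Lemma change_gens_independent : independent G -> independent change_gens.
Proof.
move=> ind n t c ac; rewrite comb_change_gens // => /(ind _ _ _ (alive_mul gP ac)).
by move=> Pc; rewrite -[c]mul1mx -(mulmx1C PQ) -mulmxA Pc mulmx0.
Qed.

(** [P] turns new coordinates into old ones and [Q] is its inverse, so the matrix of the
    differential is conjugated. *)
Lemma change_gens_tbm : total_boundary_matrix G d ->
  total_boundary_matrix change_gens (Q *m d *m P).
Proof.
move=> Gd; have gr h k : (Q *m d *m P) h k != 0 ->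
    deg (G k) = (deg (G h)).+1 /\ ent (G h) <= ent (G k).
  rewrite mxE => /sum_neq0[l _]; rewrite mulf_eq0 negb_or => /andP[+ /(gradedP gP)[<- lk]].
  rewrite mxE => /sum_neq0[g _]; rewrite mulf_eq0 negb_or.
  move=> /andP[/(gradedP gQ)[-> hg] /(proj2 Gd)[-> gl]]; split=> //.
  by apply: le_trans hg (le_trans gl lk).
split=> // k n; have [E|ne] := eqVneq (deg (G k)) n.+1; last first.
  rewrite /bdry push_deg // linear0; apply/esym/big1 => h _.
  have [->|/gr[E _]] := eqVneq ((Q *m d *m P) h k) 0; first by rewrite scale0r.
  by rewrite push_deg ?scaler0 //= -eqSS -E.
have aP : alive G n.+1 (ent (G k)) (col k P) by rewrite -E; apply: gP.
rewrite /bdry push_change_gens // (diff_comb Gd) //.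
transitivity (comb change_gens n (ent (G k)) (col k (Q *m d *m P))); last first.
  by apply: eq_bigr => h _; rewrite mxE.
rewrite colE -!mulmxA -colE comb_change_gens ?mulmxA ?PQ ?mul1mx //.
by rewrite -mulmxA; apply: (alive_mul gQ); apply: (alive_bdry Gd).
Qed.

End ChangeOfBasis.

(** * Generators inside the subcomplex they generate *)

Section GeneratedFamily.
Variables (X : pch F R) (m : nat) (G : 'I_m -> gen X).

Lemma generated_mono :
  (forall s t (h : s <= t), ch_mono (trans X h)) ->
  forall s t (h : s <= t), ch_mono (trans (generated G) h).
Proof.
move=> mono s t h n x y E; apply/val_inj/(mono _ _ h).
by have := congr1 vsval E; rewrite /= !vsprojK ?gen_span_trans ?subvsP.
Qed.

Lemma push_generated k n t :
  vsval (push (generated_gen G k) n t) = push (G k) n t.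
Proof.
case: (deg (G k) =P n) => [<-|/eqP ne]; last by rewrite !push_deg.
have [kt|tk] := leP (ent (G k)) t; last by rewrite !push_lt.
rewrite (pushE kt).
rewrite [push (generated_gen G k) _ _](@pushE _ _ _ (generated_gen G k) t kt) /=.
by rewrite vsprojK // gen_span_trans // elt_gen_span.
Qed.

Lemma comb_generated n t c : vsval (comb (generated_gen G) n t c) = comb G n t c.
Proof.
by rewrite linear_sum; apply: eq_bigr => k _; rewrite linearZ /= push_generated.
Qed.

Lemma generated_independent : independent G -> independent (generated_gen G).
Proof. by move=> ind n t c ac E; apply: (ind n t c ac); rewrite -comb_generated E. Qed.

Variable d : 'M[F]_m.
Hypothesis Gd : total_boundary_matrix G d.

Lemma generated_tbm : total_boundary_matrix (generated_gen G) d.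
Proof.
split=> [k n|]; last exact: (proj2 Gd).
apply: val_inj; rewrite /bdry /= vsprojK ?gen_span_diff ?subvsP //.
rewrite push_generated -/(bdry _ _ _) (proj1 Gd) linear_sum.
by apply: eq_bigr => h _; rewrite linearZ /= push_generated.
Qed.

Lemma generated_spanning : spanning (generated_gen G).
Proof.
move=> n t v; have /(spanP Gd)[c ac E] := subvsP v.
by exists c => //; apply: val_inj; rewrite /= E comb_generated.
Qed.

End GeneratedFamily.

(** * Discarding a pair of generators *)

Section RemovePair.
Variables (X : pch F R) (m : nat) (G : 'I_m -> gen X) (i j : 'I_m).
Local Notation G' := (remove_fam i j G).

Lemma kept_neq (l : 'I_#|kept i j|) : enum_val l != i /\ enum_val l != j.
Proof.
by have := enum_valP l; rewrite /kept !inE negb_or => /andP.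
Qed.

Definition restr (c : 'cV[F]_m) : 'cV[F]_#|kept i j| := \col_l c (enum_val l) 0.

(** Extension by zero: the sum has one term at a kept index and none at [i] or [j]. *)
Definition extend (c : 'cV[F]_#|kept i j|) : 'cV[F]_m :=
  \col_k \sum_(l | enum_val l == k) c l 0.

Lemma extendK : cancel extend restr.
Proof.
move=> c; apply/colP => l; rewrite !mxE (big_pred1 l) // => l'.
by rewrite /= (inj_eq enum_val_inj).
Qed.

Lemma extend_pair (c : 'cV[F]_#|kept i j|) : extend c i 0 = 0 /\ extend c j 0 = 0.
Proof.
by rewrite !mxE !big1 // => l /eqP E; have := kept_neq l; rewrite E eqxx; case.
Qed.

Lemma comb_restr n t (c : 'cV[F]_m) : c i 0 = 0 -> c j 0 = 0 ->
  comb G' n t (restr c) = comb G n t c.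
Proof.
move=> ci cj; rewrite /comb [RHS](bigID (mem (kept i j))) /=.
rewrite [X in _ = _ + X]big1 ?addr0 => [|k]; last first.
  by rewrite !inE negbK => /orP[] /eqP ->; rewrite ?ci ?cj scale0r.
rewrite (eq_bigr (fun l => c (enum_val l) 0 *: push (G (enum_val l)) n t)).
  by rewrite -(big_enum_val (fun k => c k 0 *: push (G k) n t)).
by move=> l _; rewrite mxE.
Qed.

Lemma comb_extend n t c : comb G n t (extend c) = comb G' n t c.
Proof. by have [ei ej] := extend_pair c; rewrite -comb_restr // extendK. Qed.

Lemma alive_restr n t c : alive G n t c -> alive G' n t (restr c).
Proof. by move=> ac l; rewrite mxE => /ac. Qed.

Lemma alive_extend n t c : alive G' n t c -> alive G n t (extend c).
Proof. by move=> ac k; rewrite mxE => /sum_neq0[l /eqP <- /ac]. Qed.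

Lemma remove_independent : independent G -> independent G'.
Proof.
move=> ind n t c ac; rewrite -comb_extend => /(ind _ _ _ (alive_extend ac)) E.
by rewrite -[c]extendK E; apply/colP => l; rewrite !mxE.
Qed.

(** Rows [i] and [j] vanish on the kept columns, so the boundary of a kept generator stays in the
    span of the kept ones. *)
Lemma remove_tbm d : total_boundary_matrix G d ->
  (forall k, k \in kept i j -> d i k = 0 /\ d j k = 0) ->
  total_boundary_matrix G' (remove_mx i j d).
Proof.
move=> Gd d0; split=> [l n|h l]; last by rewrite mxE => /(proj2 Gd).
have [di dj] := d0 _ (enum_valP l).
rewrite (bdryE Gd) lexx -comb_restr ?mxE //.
by apply: eq_bigr => h _; rewrite !mxE.
Qed.

End RemovePair.

(** * Splitting off the interval sphere once [G i] is the boundary of [G j] *)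

Section SplitOff.
Variables (X : pch F R) (m : nat) (G : 'I_m -> gen X) (i j : 'I_m) (d : 'M[F]_m).
Hypotheses (sp : spanning G) (ind : independent G) (Gd : total_boundary_matrix G d).
Hypotheses (ji_deg : deg (G j) = (deg (G i)).+1) (ij_ent : ent (G i) <= ent (G j)).
Hypotheses (dj : col j d = delta_mx i 0) (di : col i d = 0).
Hypothesis d0 : forall k, k \in kept i j -> d i k = 0 /\ d j k = 0.

Local Notation dimI := (isphere_dim (deg (G i)) (ent (G i)) (ent (G j))%:num%:E).
Local Notation I := (isphere F (deg (G i)) (ent (G i)) (ent (G j))%:num%:E).
Local Notation X' := (generated (remove_fam i j G)).

(** The interval sphere has the size of the span of the pair: [G i] accounts for degree [deg (G i)]
    and [G j] for the next one. *)
Lemma isphere_dimE t k : dimI t k =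
  ((deg (G i) == k) && (ent (G i) <= t)%R + (deg (G j) == k) && (ent (G j) <= t)%R)%N.
Proof.
rewrite /isphere_dim ji_deg lte_fin num_lt ![k == _]eq_sym.
case: (ltP t (ent (G i))) => [lt|it]; last rewrite andbT.
  by rewrite [ent (G j) <= t]leNgt (lt_le_trans lt ij_ent) !andbF.
case: (ltP t (ent (G j))) => jt; first by rewrite andbF addn0.
by rewrite andbT; case: eqP => [<-|] //; rewrite eqn_leq ltnn.
Qed.

Lemma split_neq : i != j.
Proof. by apply/eqP => ij; have := ji_deg; rewrite -ij => /n_Sn. Qed.

Definition pairc : 'cV[F]_m := delta_mx i 0 + delta_mx j 0.

Lemma comb_pair n t : comb G n t pairc = push (G i) n t + push (G j) n t.
Proof. by rewrite combD !comb_delta. Qed.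

Lemma pair_dim0 n t : dimI t n = 0%N -> comb G n t pairc = 0.
Proof.
rewrite isphere_dimE comb_pair; case: andP => // ni; case: andP => // nj _.
by rewrite !push_dead ?addr0 //; apply/andP.
Qed.

(** Reads off the only coordinate when the dimension is 1 and gives 0 when it is 0, without a case
    distinction on the type. *)
Definition rsum t n (r : isphere_obj F (deg (G i)) (ent (G i)) (ent (G j))%:num%:E t n) : F :=
  \sum_a r 0 a.

Lemma rsum_map t n t' n' r :
  @rsum t' n' (isphere_map F _ _ _ t n t' n' r) = rsum r *+ dimI t' n'.
Proof.
rewrite /rsum (eq_bigr (fun=> rsum r)) ?sumr_const ?card_ord // => a _.
by rewrite /= mxE; apply: eq_bigr => b _; rewrite mxE mulr1.
Qed.

Lemma rsum_dim0 t n r : dimI t n = 0%N -> @rsum t n r = 0.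
Proof. by move=> E; rewrite /rsum big1 // => -[a /[dup]]; rewrite {1}E. Qed.

Lemma rsum0 t n : @rsum t n 0 = 0.
Proof. by rewrite /rsum big1 // => a _; rewrite mxE. Qed.

Lemma rsum_eq0 t n r : @rsum t n r = 0 -> r = 0.
Proof.
move=> r0; apply/rowP => a; rewrite mxE -r0 /rsum (bigD1 a) //= big1 ?addr0 // => b.
have ord_0 (k : 'I_(dimI t n)) : k = 0%N :> nat.
  by apply/eqP; rewrite -leqn0 -ltnS (leq_trans (ltn_ord k)) ?isphere_dim_le1.
by case/eqP; apply: val_inj; rewrite /= !ord_0.
Qed.

(* The all-ones matrices of [isphere_map] act on [rsum] by the dimension (0 or 1)
   of their target, and in each degree at most one of the two generators is
   nonzero, so the single formula below covers all phases of the sphere. *)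
Definition split_fun t n (rx : pch_sum I X' t n) : X t n :=
  rsum rx.1 *: comb G n t pairc + vsval rx.2.

Lemma split_fun_linear t n : linear (@split_fun t n).
Proof.
move=> a [r x] [r' x']; rewrite /split_fun /= scalerDr scalerA addrACA.
congr (_ + _); rewrite -scalerDl; congr (_ *: _).
rewrite /rsum mulr_sumr -big_split; apply: eq_bigr => b _.
by rewrite !mxE.
Qed.

HB.instance Definition _ t n :=
  GRing.isLinear.Build F (pch_sum I X' t n) (X t n) _ (@split_fun t n)
    (@split_fun_linear t n).

(** The proviso excludes the phase before [G j] enters: there, in degree [deg (G i)], the left side
    is 0 while the right side is the image of [G i]. *)
Lemma diff_pair t n : dimI t n.+1 <> 0%N ->
  ch_diff (X t) n (comb G n.+1 t pairc) = comb G n t pairc *+ dimI t n.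
Proof.
have dpi : bdry (G i) n t = 0 by rewrite (bdryE Gd) di comb0 if_same.
have dpj : bdry (G j) n t = if ent (G j) <= t then push (G i) n t else 0.
  by rewrite (bdryE Gd) dj comb_delta.
rewrite !comb_pair linearD /= -!/(bdry _ _ _) dpi dpj add0r !isphere_dimE ji_deg.
case: eqP => [Ei|_] /=.
  have ne : (deg (G i) == n) = false by rewrite Ei gtn_eqF.
  have ne' : ((deg (G i)).+1 == n) = false by rewrite Ei gtn_eqF.
  rewrite ne ne' => _; rewrite mulr0n; case: ifP => // _.
  by rewrite push_deg ?ne.
rewrite add0n eqSS; case: eqP => //= En; case: (leP (ent (G j)) t) => //= jt _.
rewrite (le_trans ij_ent jt) andbT -En eqn_leq ltnn /= mulr1n.
by rewrite [push (G j) _ _]push_deg ?addr0 // ji_deg eqn_leq ltnn.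
Qed.

Lemma trans_pair s t (h : s <= t) n : dimI s n <> 0%N ->
  trans X h n (comb G n s pairc) = comb G n t pairc *+ dimI t n.
Proof.
rewrite !comb_pair linearD /= !isphere_dimE ji_deg.
case: eqP => [<-|/eqP ne] /=.
  rewrite ![push (G j) _ _]push_deg ?ji_deg ?eqn_leq ?ltnn // linear0 !addr0 addn0.
  case: leP => // is_ _; rewrite (le_trans is_ h) mulr1n.
  by rewrite trans_push.
rewrite !add0n ![push (G i) _ _]push_deg // linear0 !add0r.
case: eqP => //= _; case: leP => // js _; rewrite (le_trans js h) mulr1n.
by rewrite trans_push.
Qed.

Lemma split_fun_diff t n (rx : pch_sum I X' t n.+1) :
  split_fun (ch_diff (pch_sum I X' t) n rx) = ch_diff (X t) n (split_fun rx).
Proof.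
case: rx => r x; rewrite /split_fun linearD linearZ.
rewrite [vsval _]/= vsprojK ?gen_span_diff ?subvsP //; congr (_ + _).
rewrite rsum_map /=; case: (dimI t n.+1 =P 0%N) => [E|/diff_pair ->].
  by rewrite rsum_dim0 // mul0rn !scale0r.
by rewrite -scalerMnl -scalerMnr.
Qed.

Lemma split_fun_trans s t (h : s <= t) n (rx : pch_sum I X' s n) :
  split_fun (trans (pch_sum I X') h n rx) = trans X h n (split_fun rx).
Proof.
case: rx => r x; rewrite /split_fun linearD linearZ.
rewrite [vsval _]/= vsprojK ?gen_span_trans ?subvsP //; congr (_ + _).
rewrite rsum_map /=; case: (dimI s n =P 0%N) => [E|/trans_pair ->].
  by rewrite rsum_dim0 // mul0rn !scale0r.
by rewrite -scalerMnl -scalerMnr.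
Qed.

Lemma split_fun_inj t n : injective (@split_fun t n).
Proof.
suff ker0 rx : @split_fun t n rx = 0 -> rx = 0.
  by move=> x y E; apply/eqP; rewrite -subr_eq0; apply/eqP/ker0; rewrite linearB /= E subrr.
case: rx => r x; rewrite /split_fun /=.
move=> E; suff r0 : r = 0.
  move: E; rewrite r0 rsum0 scale0r add0r => x0.
  by congr (_, _); apply: val_inj.
apply: rsum_eq0; have [c ac xc] := spanP (remove_tbm Gd d0) _ (subvsP x).
(* [C] collects the coordinates of the image of [(r, x)]. Since [extend c] vanishes at [i] and [j],
   these two entries see only the sphere. *)
pose C := trunc G n t (rsum r *: pairc) + extend c.
have C0 : C = 0.
  apply: ind; first by apply: aliveD; [exact: alive_trunc | exact: alive_extend ac].
  by rewrite combD comb_trunc combZ comb_extend -xc.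
have [ci cj] := extend_pair c.
have Ci := congr1 (fun M : 'cV_m => M i 0) C0; rewrite mxE ci addr0 in Ci.
have Cj := congr1 (fun M : 'cV_m => M j 0) C0; rewrite mxE cj addr0 in Cj.
(* If one of the two generators is alive, its entry is [rsum r]; if neither is, the sphere has
   dimension 0 here. *)
move: Ci Cj; rewrite !mxE !eqxx [j == i]eq_sym (negbTE split_neq) /= addr0 add0r mulr1.
have := isphere_dimE t n; case: ifP => [//|_]; case: ifP => [//|_] dim0 _ _.
exact: rsum_dim0.
Qed.

Lemma split_fun_surj t n v : exists rx, @split_fun t n rx = v.
Proof.
have [c ac ->] := sp v.
(* The degrees of [G i] and [G j] differ, so at most one summand is non-zero and [b] is the
   coefficient of whichever generator is alive. *)
pose b := c i 0 + c j 0.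
pose c' := c - trunc G n t (b *: pairc).
have ac' : alive G n t c'.
  by rewrite /c' -scaleN1r; apply/aliveD/aliveZ/alive_trunc.
have zero : c' i 0 = 0 /\ c' j 0 = 0.
  rewrite /c' !mxE !eqxx [j == i]eq_sym (negbTE split_neq) /= addr0 add0r mulr1 /b.
  have az k : ~~ ((deg (G k) == n) && (ent (G k) <= t)) -> c k 0 = 0.
    by apply: contraNeq => /ac[-> ->]; rewrite eqxx.
  have nn k : (k.+1 == k) = false by rewrite gtn_eqF.
  split; case: ifP => [/andP[/eqP En _]|/negbT/az E]; rewrite ?E ?subr0 //.
    by rewrite (az j) ?addr0 ?subrr // ji_deg En nn.
  by rewrite (az i) ?add0r ?subrr // -En ji_deg eq_sym nn.
have xU : comb G n t c' \in gen_span (remove_fam i j G) n t.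
  apply/(spanP (remove_tbm Gd d0)); exists (restr i j c'); first exact: alive_restr.
  by case: zero => ? ?; rewrite comb_restr.
exists (const_mx b, Subvs xU); rewrite /split_fun /=.
have -> : @rsum t n (const_mx b) = b *+ dimI t n.
  by rewrite /rsum (eq_bigr (fun=> b)) ?sumr_const ?card_ord // => a _; rewrite mxE.
have -> : (b *+ dimI t n) *: comb G n t pairc = b *: comb G n t pairc.
  have := isphere_dim_le1 (deg (G i)) (ent (G i)) (ent (G j))%:num%:E t n.
  case: (dimI t n =P 0%N) => [/pair_dim0 ->|]; first by rewrite !scaler0.
  by case: (dimI t n) => [|[|]].
by rewrite -combZ -comb_trunc -combD addrC subrK.
Qed.

Lemma split_isom : pch_isom X (pch_sum I X').
Proof.
apply: pch_isom_sym.
pose f t : chmap (pch_sum I X' t) (X t) :=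
  @ChMap F _ (X t) (fun n => @split_fun t n) (@split_fun_diff t).
apply: (@bij_pch_isom _ _ (@PMap F R _ X f split_fun_trans)) => t n /=.
  exact: split_fun_inj.
exact: split_fun_surj.
Qed.

End SplitOff.
End Combinations.

(** * Matrix algebra of the pivot entry *)

Section Pivot.
Set Implicit Arguments.
Unset Strict Implicit.
Variables (F : fieldType) (m : nat) (i j : 'I_m) (d : 'M[F]_m).
Hypotheses (dij : d i j != 0) (dii : d i i = 0) (djj : d j j = 0) (ij : i != j).
Hypothesis dd : d *m d = 0.

(** Added to the identity, this rank-one matrix replaces the [i]-th unit column by the coordinates
    of the boundary of [G j]. *)
Definition pivot_col : 'M[F]_m := (col j d - delta_mx i 0) *m (delta_mx 0 i : 'rV_m).

(** Subtracting it takes [(d i j)^-1 * d i k] times [G j] off [G k], which clears the entry of the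
    boundary in row [i]; the term [delta_mx 0 j] leaves [G j] itself unchanged. *)
Definition pivot_row : 'M[F]_m :=
  (delta_mx j 0 : 'cV_m) *m ((d i j)^-1 *: row i d - delta_mx 0 j).

(* Column [k] holds the coordinates of the [k]-th new generator. *)
Definition pivot : 'M[F]_m := 1%:M + pivot_col - pivot_row.

(** With [A] and [B] for [pivot_col] and [pivot_row] and [a = d i j], one has [AA = (a - 1)A] and
    [AB = BA = BB = 0]; hence [1 - a^-1 A + B] inverts [1 + A - B]. *)
Definition pivot_inv : 'M[F]_m := 1%:M - (d i j)^-1 *: pivot_col + pivot_row.

Lemma pivot_colE h k : pivot_col h k = (d h j - (h == i)%:R) * (k == i)%:R.
Proof. by rewrite !mxE big_ord1 !mxE eqxx andbT. Qed.

Lemma pivot_rowE h k :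
  pivot_row h k = (h == j)%:R * ((d i j)^-1 * d i k - (k == j)%:R).
Proof. by rewrite !mxE big_ord1 !mxE eqxx andbT. Qed.

Lemma mul_delta (r : 'rV[F]_m) k : r *m (delta_mx k 0 : 'cV_m) = (r 0 k)%:M.
Proof. by rewrite -colE; apply/matrixP => a b; rewrite !ord1 !mxE eqxx. Qed.

Lemma delta_mul (c : 'cV[F]_m) k : (delta_mx 0 k : 'rV_m) *m c = (c k 0)%:M.
Proof. by rewrite -rowE; apply/matrixP => a b; rewrite !ord1 !mxE eqxx. Qed.

Lemma outer_mul (a a' : 'cV[F]_m) (b b' : 'rV[F]_m) :
  (a *m b) *m (a' *m b') = (b *m a') 0 0 *: (a *m b').
Proof.
by rewrite -mulmxA (mulmxA b) {1}[b *m a']mx11_scalar mul_scalar_mx -scalemxAr.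
Qed.

Lemma addr_telescope (V : zmodType) (x y z u : V) : x - y + z + (u + (y - u)) - z = x.
Proof. by rewrite [u + _]addrC subrK (addrAC _ z y) subrK addrK. Qed.

Lemma pivotV : pivot *m pivot_inv = 1%:M.
Proof.
have AA : pivot_col *m pivot_col = (d i j - 1) *: pivot_col.
  by rewrite outer_mul delta_mul !mxE !eqxx.
have AB : pivot_col *m pivot_row = 0.
  by rewrite outer_mul delta_mul !mxE (negbTE ij) scale0r.
(* The scalar factor is built from the [(i, j)] entry of [d *m d] and the diagonal entries of [d] at
   [i] and [j], all zero. *)
have BA : pivot_row *m pivot_col = 0.
  rewrite outer_mul mulmxBr mul_delta mulmxBl delta_mul -scalemxAl.
  have -> : row i d *m col j d = 0.
    by rewrite rowE colE mulmxA -(mulmxA _ d d) dd mulmx0 mul0mx.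
  by rewrite !mxE dii djj !eqxx (negbTE ij) !mulr0 !subr0 scale0r.
have BB : pivot_row *m pivot_row = 0.
  by rewrite outer_mul mul_delta !mxE mulVf // !eqxx subrr mul0rn scale0r.
rewrite /pivot mulmxBl mulmxDl mul1mx /pivot_inv !mulmxDr mulmx1 !mulmxN !mulmx1.
rewrite -!scalemxAr AA AB BA BB scaler0 subr0 !addr0.
rewrite scalerA mulrBr mulVf // mulr1 scalerBl scale1r opprB.
exact: addr_telescope.
Qed.

Lemma pivotE h k : pivot h k = (h == k)%:R + (d h j - (h == i)%:R) * (k == i)%:R
  - (h == j)%:R * ((d i j)^-1 * d i k - (k == j)%:R).
Proof.
rewrite -pivot_colE -pivot_rowE /pivot mxE [X in X + _]mxE [X in _ + X]mxE.
by rewrite [1%:M h k]mxE.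
Qed.

Lemma pivot_invE h k : pivot_inv h k =
  (h == k)%:R - (d i j)^-1 * ((d h j - (h == i)%:R) * (k == i)%:R)
  + (h == j)%:R * ((d i j)^-1 * d i k - (k == j)%:R).
Proof.
rewrite -pivot_colE -pivot_rowE /pivot_inv mxE [X in X + _]mxE [X in _ + X + _]mxE.
by rewrite [1%:M h k]mxE [X in - X]mxE.
Qed.

Lemma col_pivot k : col k pivot =
  if k == i then col j d
  else delta_mx k 0 - ((d i j)^-1 * d i k - (k == j)%:R) *: delta_mx j 0.
Proof.
apply/colP => h; rewrite mxE pivotE.
have [->|ki] := eqVneq k i; rewrite !mxE.
  by rewrite dii (negbTE ij) mulr0 subr0 mulr0 subr0 mulr1 addrC subrK.
by rewrite mulr0 addr0 !andbT mulrC.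
Qed.

Lemma row_pivot_inv h : row h pivot_inv =
  delta_mx 0 h - ((d i j)^-1 * (d h j - (h == i)%:R)) *: delta_mx 0 i
  + (h == j)%:R *: ((d i j)^-1 *: row i d - delta_mx 0 j).
Proof.
apply/rowP => k; rewrite mxE pivot_invE !mxE !eqxx /=.
by rewrite [k == h]eq_sym mulrA.
Qed.

Definition pivoted : 'M[F]_m := pivot_inv *m d *m pivot.

Lemma row_pivot_inv_i : row i pivot_inv = (d i j)^-1 *: delta_mx 0 i.
Proof.
rewrite row_pivot_inv eqxx (negbTE ij) scale0r addr0 mulrBr mulVf // mulr1.
by rewrite scalerBl scale1r subKr.
Qed.

Lemma row_pivot_inv_j : row j pivot_inv = (d i j)^-1 *: row i d.
Proof.
rewrite row_pivot_inv djj [j == i]eq_sym (negbTE ij) eqxx subrr mulr0 scale0r subr0 scale1r.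
by rewrite addrC subrK.
Qed.

Lemma col_pivoted_j : col j pivoted = delta_mx i 0.
Proof.
have ji : j != i by rewrite eq_sym.
rewrite colE /pivoted -!mulmxA -(colE j pivot) col_pivot (negbTE ji) eqxx mulVf //.
rewrite subrr scale0r subr0 -colE.
have <- : col i pivot = col j d by rewrite col_pivot eqxx.
by rewrite colE mulmxA (mulmx1C pivotV) mul1mx.
Qed.

Lemma col_pivoted_i : col i pivoted = 0.
Proof.
rewrite colE /pivoted -!mulmxA -(colE i pivot) col_pivot eqxx colE.
by rewrite (mulmxA d) dd mul0mx mulmx0.
Qed.

(** Row [i] of [pivot_inv] times [d] is row [j] of [pivot_inv], which [pivot] carries to a unit
    row. *)
Lemma row_pivoted_i : row i pivoted = delta_mx 0 j.
Proof.
rewrite rowE /pivoted !mulmxA -rowE row_pivot_inv_i -scalemxAl -rowE.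
by rewrite -row_pivot_inv_j rowE -mulmxA (mulmx1C pivotV) mulmx1.
Qed.

(** Row [j] of [pivot_inv] is a multiple of row [i] of [d], so a further factor [d] kills it. *)
Lemma row_pivoted_j : row j pivoted = 0.
Proof.
rewrite rowE /pivoted !mulmxA -rowE row_pivot_inv_j -scalemxAl.
by rewrite rowE -(mulmxA _ d d) dd mulmx0 scaler0 mul0mx.
Qed.

(** The row and column operations each subtract the same term, and their cross term through [d i j]
    adds it back once. So the row operation of [clear_rows] alone yields the same entries. *)
Lemma pivotedE h k : h != i -> h != j -> k != i -> k != j ->
  pivoted h k = d h k - (d i j)^-1 * d h j * d i k.
Proof.
move=> hi hj ki kj.
have -> : pivoted h k = (row h pivoted *m (delta_mx k 0 : 'cV_m)) 0 0.
  by rewrite -colE !mxE.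
rewrite rowE /pivoted -!mulmxA -(colE k pivot) !mulmxA -rowE.
rewrite row_pivot_inv col_pivot (negbTE hi) (negbTE hj) (negbTE ki) (negbTE kj).
rewrite !subr0 scale0r addr0 mulmxBl -scalemxAl -!rowE mulmxBr -scalemxAr !mulmxBl.
rewrite -!scalemxAl !mul_delta !mxE eqxx !mulr1n.
rewrite (mulrC (_^-1) (d i k)) mulrBr -!mulrA.
by rewrite [d h j * d i j]mulrC mulKf // subrr subr0.
Qed.

Lemma remove_pivoted : remove_mx i j (clear_rows i j d) = remove_mx i j pivoted.
Proof.
apply/matrixP => h k; have [hi hj] := kept_neq h; have [ki kj] := kept_neq k.
rewrite [LHS]mxE [RHS]mxE pivotedE // mxE.
case: eqP => [->|_] /=; first by rewrite !mxE mulr0 mul0r subr0.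
by rewrite !mxE mulNr.
Qed.

End Pivot.

(** * Assembling the decomposition *)

Theorem proposition3p2 (p : nat) (p_prime : prime p) (R : realType)
    (X : pch 'F_p R) (X_filtered : filtered X)
    (X_diff : exists (t : time R) (n : nat) (x : X t n.+1), ch_diff (X t) n x != 0)
    (m : nat) (G : 'I_m -> gen X) (G_qmin : quasi_minimal G)
    (d : 'M['F_p]_m) (d_tbm : total_boundary_matrix G d)
    (i j : 'I_m) (ij_split : split_conditions G d i j) :
  exists Gt : 'I_m -> gen X, quasi_minimal Gt /\
    let G' := remove_fam i j Gt in
    let X' := generated G' in
    [/\ [/\ Gt j = G j,
            forall n, push (Gt i) n (ent (G j)) = bdry (G j) n (ent (G j)) &
            exists2 dt : 'M['F_p]_m, total_boundary_matrix Gt dt &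
              split_conditions Gt dt i j],
        forall k, deg (Gt k) = deg (G k) /\ ent (Gt k) = ent (G k),
        filtered X' /\
        pch_isom X (pch_sum (isphere 'F_p (deg (Gt i)) (ent (Gt i))
                               (ent (Gt j))%:num%:E) X') &
        quasi_minimal (generated_gen G') /\
        total_boundary_matrix (generated_gen G')
          (remove_mx i j (clear_rows i j d))].
Proof.
have mono := proj2 X_filtered.
have ind := qmin_independent mono G_qmin.
have sp : spanning G.
  by move=> n t v; apply/(spanP d_tbm); rewrite (proj1 G_qmin) memvf.
case: ij_split => dij; rewrite !inE dij /= => /forallP imax /forallP jmin.
have [ji_deg ij_ent] := proj2 d_tbm _ _ dij.
have ddiag k : d k k = 0.
  by apply/eqP/negPn/negP => /(proj2 d_tbm)[/n_Sn].
have ij : i != j by apply/eqP => E; move: dij; rewrite E ddiag eqxx.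
have dd := tbm_sqr d_tbm ind.
(* SC2: the boundary of [G j] already exists when [G i] enters. *)
have dj_graded h : d h j != 0 -> deg (G h) = deg (G i) /\ ent (G h) <= ent (G i).
  move=> hj; split; last by have := imax h; rewrite hj.
  by have [] := proj2 d_tbm _ _ hj; rewrite ji_deg => -[].
(* SC3: [G j] is present whenever a multiple of it must be subtracted from [G k]. *)
have di_graded k : d i k != 0 -> deg (G j) = deg (G k) /\ ent (G j) <= ent (G k).
  move=> ik; split; last by have := jmin k; rewrite ik.
  by have [-> _] := proj2 d_tbm _ _ ik.
have gA : graded G (pivot_col i j d).
  move=> k h; rewrite mxE pivot_colE mulf_eq0 negb_or => /andP[].
  have [->|ki] := eqVneq k i; last by rewrite eqxx.
  by have [->|hi] := eqVneq h i; rewrite ?lexx // subr0 => /dj_graded.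
have gB : graded G (pivot_row i j d).
  move=> k h; rewrite mxE pivot_rowE mulf_eq0 negb_or => /andP[].
  have [->|hj] := eqVneq h j; last by rewrite eqxx.
  have [->|kj] := eqVneq k j; rewrite ?lexx // subr0 mulf_eq0 negb_or.
  by move=> _ /andP[_ /di_graded].
have gP : graded G (pivot i j d).
  by rewrite /pivot -scaleN1r; apply/gradedD/gradedZ/gB/gradedD/gA/graded1.
have gQ : graded G (pivot_inv i j d).
  rewrite /pivot_inv -scaleNr; apply/gradedD/gB/gradedD/gradedZ/gA/graded1.
have PQ := pivotV dij (ddiag i) (ddiag j) ij dd.
pose Gt := change_gens G (pivot i j d); pose dt := pivoted i j d.
have tbm : total_boundary_matrix Gt dt := change_gens_tbm gP gQ PQ d_tbm.
have spt : spanning Gt := change_gens_spanning gP gQ PQ sp.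
have indt : independent Gt := change_gens_independent gP PQ ind.
have dtj := col_pivoted_j dij (ddiag i) (ddiag j) ij dd.
have dti := col_pivoted_i (ddiag i) ij dd.
have rti := row_pivoted_i dij (ddiag i) (ddiag j) ij dd.
have rtj := row_pivoted_j (ddiag j) ij dd.
exists Gt; split; first exact: basis_qmin.
have d0 k : k \in kept i j -> dt i k = 0 /\ dt j k = 0.
  rewrite !inE negb_or => /andP[ki kj].
  have := congr1 (fun M : 'rV_m => M 0 k) rti.
  have := congr1 (fun M : 'rV_m => M 0 k) rtj.
  by rewrite mxE => ->; rewrite mxE => ->; rewrite !mxE (negbTE kj).
have tbm' := remove_tbm tbm d0.
have mono' : forall s t (h : s <= t), ch_mono (trans (generated (remove_fam i j Gt)) h).
  exact: generated_mono.
have sp' := generated_spanning tbm'.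
split.
- split.
  + apply: change_gens_id.
    (* For [k = j] the multiple of [G j] subtracted is [(d i j)^-1 * d i j - 1 = 0]. *)
    rewrite (col_pivot (ddiag i) ij) eq_sym (negbTE ij) eqxx mulVf // subrr.
    by rewrite scale0r subr0.
  + move=> n; rewrite push_change_gens // (col_pivot (ddiag i) ij) eqxx.
    by rewrite (bdryE d_tbm) lexx.
  + exists dt => //.
    have dtjE h : dt h j = (h == i)%:R.
      by have := congr1 (fun M : 'cV_m => M h 0) dtj; rewrite !mxE eqxx andbT.
    have dtiE k : dt i k = (k == j)%:R.
      by have := congr1 (fun M : 'rV_m => M 0 k) rti; rewrite !mxE eqxx.
    (* Row [i] and column [j] of [dt] have a single non-zero entry, so the maximum and the minimum
       range over one index. *)
    split; rewrite ?inE /= dtjE eqxx oner_eq0 //=; apply/forallP => h.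
      by rewrite dtjE; have [->|_] := eqVneq h i; rewrite ?lexx ?implybT ?eqxx.
    by rewrite dtiE; have [->|_] := eqVneq h j; rewrite ?lexx ?implybT ?eqxx.
- by [].
- split; last exact: (split_isom spt indt tbm ji_deg ij_ent dtj dti d0).
  by split=> //; apply: spanning_tame sp' mono'.
- split.
    by apply: basis_qmin sp' _; apply: generated_independent; apply: remove_independent.
  by rewrite remove_pivoted //; apply: generated_tbm.
Qed.
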